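(* Let $n\ge1$. If a $\mathrm{GBS}_n$ group $G$ is non-solvable and unimodular (i.e. $G$ is virtually $\mathbb{Z}^n\times\mathbb{F}_k$ for some $k\ge2$), then $\Sigma(G)=S(G,Z(G))^c$, where $Z(G)$ is the center of $G$.
   Context: A $\mathrm{GBS}_n$ group (rank $n$ generalized Baumslag-Solitar group) is the fundamental group of a finite graph of groups all of whose edge and vertex groups are isomorphic to $\mathbb{Z}^n$. ''Virtually $\mathbb{Z}^n\times\mathbb{F}_k$'' means having a finite index subgroup isomorphic to $\mathbb{Z}^n\times\mathbb{F}_k$, with $\mathbb{F}_k$ the free group of rank $k$. For a finitely generated group $G$, $S(G)$ is the sphere of classes $[\varphi]$ of nonzero homomorphisms $\varphi:G\to\mathbb{R}$, where $[\varphi]=[\psi]$ iff $\varphi=\lambda\psi$ for some real $\lambda>0$. For a finite generating set $\mathcal{G}$ of $G$, $\mathrm{Cay}(G,\mathcal{G})$ is the Cayley graph with vertex set $G$ and edges joining $g$ to $gs$ for $s\in\mathcal{G}$, and $\mathrm{Cay}(G,\mathcal{G})^{[0,\infty)}$ is its induced subgraph on $\{g:\varphi(g)\ge0\}$. The Bieri-Neumann-Strebel invariant $\Sigma(G)\subset S(G)$ is the set of $[\varphi]$ such that $\mathrm{Cay}(G,\mathcal{G})^{[0,\infty)}$ is connected for some (equivalently every) finite generating set $\mathcal{G}$. For a subgroup $H\subset G$, $S(G,H)=\{[\varphi]\in S(G):H\subset\ker\varphi\}$ and $S(G,H)^c$ is its complement in $S(G)$. *)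

(* Defs.v *)
From HB Require Import structures.
From Stdlib Require Import Relation_Operators.
From mathcomp Require Import all_boot all_order all_algebra.
From mathcomp Require Import boolp classical_sets functions cardinality reals.

Set Implicit Arguments.
Unset Strict Implicit.
Unset Printing Implicit Defensive.

Import Order.TTheory GRing.Theory Num.Theory.

Local Open Scope classical_set_scope.
Local Open Scope quotient_scope.
Local Open Scope group_scope.

Local Notation to_multiplicative := nmodule.Algebra.to_multiplicative.

Section Presentation.
Variables (X : choiceType) (rels : set (seq (X * bool))).

(* The letter (x, true) stands for x, and (x, false) for its formal inverse. *)
Notation word := (seq (X * bool)).

Inductive pres_eq : word -> word -> Prop :=
| pres_eq_refl u : pres_eq u u
| pres_eq_sym u v : pres_eq u v -> pres_eq v u
| pres_eq_trans u v w : pres_eq u v -> pres_eq v w -> pres_eq u w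
| pres_eq_cat u u' v v' : pres_eq u u' -> pres_eq v v' ->
    pres_eq (u ++ v) (u' ++ v')
| pres_eq_cancel x b : pres_eq [:: (x, b); (x, ~~ b)] [::]
| pres_eq_rel r : rels r -> pres_eq r [::].

Definition pres_eqb : rel word := fun u v => `[< pres_eq u v >].

Lemma pres_eqb_refl : reflexive pres_eqb.
Proof. by move=> u; apply/asboolP; exact: pres_eq_refl. Qed.

Lemma pres_eqb_sym : symmetric pres_eqb.
Proof.
by move=> u v; apply/idP/idP => /asboolP uv; apply/asboolP; exact: pres_eq_sym.
Qed.

Lemma pres_eqb_trans : transitive pres_eqb.
Proof.
move=> v u w /asboolP uv /asboolP vw; apply/asboolP.
exact: pres_eq_trans uv vw.
Qed.

Canonical pres_equiv := EquivRel pres_eqb pres_eqb_refl pres_eqb_sym pres_eqb_trans.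

Definition presented_group : Type := {eq_quot pres_equiv}.
HB.instance Definition _ := Choice.on presented_group.
HB.instance Definition _ := EqQuotient.on presented_group.

Definition word_inv (u : word) : word := [seq (p.1, ~~ p.2) | p <- rev u].

Definition pres_one : presented_group := \pi_presented_group [::].
Definition pres_mul (a b : presented_group) : presented_group :=
  \pi_presented_group (repr a ++ repr b).
Definition pres_inv (a : presented_group) : presented_group :=
  \pi_presented_group (word_inv (repr a)).

Lemma pres_piP (u v : word) :
  \pi_presented_group u = \pi_presented_group v <-> pres_eq u v.
Proof. by split=> [/eqmodP/asboolP //|uv]; apply/eqmodP/asboolP. Qed.

Lemma pres_reprP (u : word) : pres_eq (repr (\pi_presented_group u)) u.
Proof. by apply/pres_piP; rewrite reprK. Qed.

Lemma pres_pi_cat (u v : word) :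
  pres_mul (\pi_presented_group u) (\pi_presented_group v) =
  \pi_presented_group (u ++ v).
Proof. by apply/pres_piP; apply: pres_eq_cat; exact: pres_reprP. Qed.

Lemma word_invK : involutive word_inv.
Proof.
move=> u; rewrite /word_inv -map_rev revK -map_comp -[RHS]map_id.
by apply: eq_map => -[x b] /=; rewrite negbK.
Qed.

Lemma pres_eq_catV (u : word) : pres_eq (u ++ word_inv u) [::].
Proof.
elim/last_ind: u => [|u [x b] IHu]; first exact: pres_eq_refl.
rewrite /word_inv rev_rcons /= -cats1 -catA /=.
apply: pres_eq_trans IHu; apply: pres_eq_cat (pres_eq_refl u) _.
exact: pres_eq_cat (pres_eq_cancel x b) (pres_eq_refl (word_inv u)).
Qed.

Lemma pres_eq_Vcat (u : word) : pres_eq (word_inv u ++ u) [::].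
Proof. by rewrite -{2}[u]word_invK; exact: pres_eq_catV. Qed.

Lemma pres_mulA : associative pres_mul.
Proof.
elim/quotW=> u; elim/quotW=> v; elim/quotW=> w.
by rewrite (pres_pi_cat v w) (pres_pi_cat u v) (pres_pi_cat u) (pres_pi_cat _ w) catA.
Qed.

Lemma pres_mul1 : left_id pres_one pres_mul.
Proof. by elim/quotW=> u; rewrite /pres_one pres_pi_cat. Qed.

Lemma pres_mulr1 : right_id pres_one pres_mul.
Proof. by elim/quotW=> u; rewrite /pres_one pres_pi_cat cats0. Qed.

Lemma pres_mulV : left_inverse pres_one pres_inv pres_mul.
Proof.
move=> a; rewrite -{2}[a]reprK /pres_inv pres_pi_cat; apply/pres_piP.
exact: pres_eq_Vcat.
Qed.

Lemma pres_mulrV : right_inverse pres_one pres_inv pres_mul.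
Proof.
move=> a; rewrite -{1}[a]reprK /pres_inv pres_pi_cat; apply/pres_piP.
exact: pres_eq_catV.
Qed.

HB.instance Definition _ := isGroup.Build presented_group
  pres_mulA pres_mul1 pres_mulr1 pres_mulV pres_mulrV.

Definition pres_gen (x : X) : presented_group :=
  \pi_presented_group [:: (x, true)].

End Presentation.

Definition free_group (k : nat) : groupType :=
  @presented_group 'I_k set0.

Definition free_abelian_group (n : nat) : groupType :=
  to_multiplicative 'rV[int]_n.

Definition isomorphic (G H : groupType) : Prop :=
  exists f : {multiplicative G -> H}, bijective f.

(* Each geometric edge is listed once, with a chosen orientation; loops and
   multiple edges are allowed. *)
Record graph_of_groups := GraphOfGroups {
  gog_vertex : finType;
  gog_edge : finType;
  gog_src : gog_edge -> gog_vertex;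
  gog_tgt : gog_edge -> gog_vertex;
  gog_connected : forall u v : gog_vertex,
    clos_refl_sym_trans gog_vertex
      (fun x y => exists e, gog_src e = x /\ gog_tgt e = y) u v;
  gog_vgroup : gog_vertex -> groupType;
  gog_egroup : gog_edge -> groupType;
  gog_srcmap : forall e, {multiplicative gog_egroup e -> gog_vgroup (gog_src e)};
  gog_tgtmap : forall e, {multiplicative gog_egroup e -> gog_vgroup (gog_tgt e)};
  gog_srcmap_inj : forall e, injective (gog_srcmap e);
  gog_tgtmap_inj : forall e, injective (gog_tgtmap e)
}.

Section FundamentalGroup.
Variable A : graph_of_groups.

(* The generators are the elements of all vertex groups together with one
   stable letter per edge. *)
Definition path_gen : choiceType :=
  ({v : gog_vertex A & gog_vgroup v} + gog_edge A)%type.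

Definition vgen (v : gog_vertex A) (g : gog_vgroup v) : path_gen :=
  inl (existT _ v g).
Definition egen (e : gog_edge A) : path_gen := inr e.

(* g h = (g h) in each vertex group, and t_e tgt_e(a) t_e^-1 = src_e(a). *)
Inductive path_rels : set (seq (path_gen * bool)) :=
| path_rel_vertex (v : gog_vertex A) (g h : gog_vgroup v) :
    path_rels [:: (vgen g, true); (vgen h, true); (vgen (g * h), false)]
| path_rel_edge (e : gog_edge A) (a : gog_egroup e) :
    path_rels [:: (egen e, true); (vgen (gog_tgtmap e a), true);
                  (egen e, false); (vgen (gog_srcmap e a), false)].

(* Serre's group F(A), in which the fundamental groups of A live. *)
Definition path_group : groupType := presented_group path_rels.

Definition vertex_elt (v : gog_vertex A) (g : gog_vgroup v) : path_group :=
  pres_gen path_rels (vgen g).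
Definition edge_elt (e : gog_edge A) : path_group :=
  pres_gen path_rels (egen e).

(* path_elt v w x: x is the element g0 t1 g1 ... tm gm of F(A) carried by some
   edge path from v to w, with each gi in the vertex group at the i-th vertex. *)
Inductive path_elt (v : gog_vertex A) : gog_vertex A -> path_group -> Prop :=
| path_elt_nil (g : gog_vgroup v) : path_elt v v (vertex_elt g)
| path_elt_fwd e (g : gog_vgroup (gog_tgt e)) x :
    path_elt v (gog_src e) x ->
    path_elt v (gog_tgt e) (x * edge_elt e * vertex_elt g)
| path_elt_bwd e (g : gog_vgroup (gog_src e)) x :
    path_elt v (gog_tgt e) x ->
    path_elt v (gog_src e) (x * (edge_elt e)^-1 * vertex_elt g).

Definition fundamental_group (v : gog_vertex A) : set path_group :=
  [set x | path_elt v v x].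

End FundamentalGroup.

Definition is_fundamental_group_of (A : graph_of_groups) (G : groupType) : Prop :=
  exists (v : gog_vertex A) (f : {multiplicative G -> path_group A}),
    injective f /\ range f = fundamental_group v.

Definition is_GBS (n : nat) (G : groupType) : Prop :=
  exists A : graph_of_groups,
    [/\ forall v : gog_vertex A, isomorphic (gog_vgroup v) (free_abelian_group n),
        forall e : gog_edge A, isomorphic (gog_egroup e) (free_abelian_group n)
      & is_fundamental_group_of A G].

Definition is_subgroup (G : groupType) (H : set G) : Prop :=
  [/\ H 1, forall x y, H x -> H y -> H (x * y) & forall x, H x -> H x^-1].

Definition generates (G : groupType) (S : set G) : Prop :=
  forall H : set G, is_subgroup H -> S `<=` H -> H = setT.

Definition finite_index (G : groupType) (H : set G) : Prop :=
  finite_set (range (fun g : G => [set g * h | h in H])).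

Definition virtually_Zn_x_Fk (n k : nat) (G : groupType) : Prop :=
  exists f : {multiplicative (free_abelian_group n * free_group k)%type -> G},
    injective f /\ finite_index (range f).

Definition group_center (G : groupType) : set G :=
  [set z | forall g : G, commute z g].

Section BNS.
Variables (R : realType) (G : groupType).
Local Open Scope ring_scope.

Definition is_character (phi : G -> R) : Prop :=
  {morph phi : x y / (x * y)%g >-> x + y}.

Definition nonzero_char (phi : G -> R) : Prop :=
  is_character phi /\ exists g, phi g <> 0.

Definition char_class (phi : G -> R) : set (G -> R) :=
  [set psi | nonzero_char psi /\
    exists2 c : R, 0 < c & forall g, phi g = c * psi g].

Definition char_sphere : set (set (G -> R)) :=
  [set char_class phi | phi in nonzero_char].

Definition char_sphere_rel (H : set G) : set (set (G -> R)) :=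
  [set char_class phi | phi in
    [set phi | nonzero_char phi /\ forall h, H h -> phi h = 0]].

(* Edges of the Cayley graph lying in the half {phi >= 0}, oriented by S. *)
Definition half_cayley_edge (S : set G) (phi : G -> R) (x y : G) : Prop :=
  [/\ 0 <= phi x, 0 <= phi y & exists2 s, S s & y = (x * s)%g].

Definition half_cayley_connected (S : set G) (phi : G -> R) : Prop :=
  forall x y : G, 0 <= phi x -> 0 <= phi y ->
    clos_refl_sym_trans G (half_cayley_edge S phi) x y.

Definition BNS_invariant : set (set (G -> R)) :=
  [set char_class phi | phi in
    [set phi | nonzero_char phi /\
      exists S : set G, [/\ finite_set S, generates S
                          & half_cayley_connected S phi]]].

End BNS.

Arguments BNS_invariant R G : clear implicits.
Arguments char_sphere R G : clear implicits.
Arguments char_sphere_rel R {G} H.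
Arguments group_center G : clear implicits.

(* Main.v *)
(* Let H = Z^n x F_k be the finite index subgroup.  If phi(z) > 0 for a central
   z, any path of the Cayley graph is pushed into the half space phi >= 0 by
   multiplying it by a large power of z, so the half space is connected.
   Conversely, let phi vanish on the center.  Then phi vanishes on Z^n, because
   an element of Z^n has a power whose conjugates commute and multiply to a
   central element; so phi restricts to a nonzero character psi of F_k.  A path
   of G in phi >= 0 projects to a coarse path of the tree of F_k on which psi is
   bounded below.  But for a letter l with psi(l) < 0 and a generator u other
   than l, the path from 1 to l^N u l^(-2N) has to cross the edge that leaves
   l^N along u, although psi(l^N) is as negative as we like. *)
Require Import Defs.
From mathcomp Require Import fingroup perm.
From mathcomp Require Import all_boot all_order all_algebra.
From mathcomp Require Import lra.
From mathcomp Require Import finmap boolp classical_sets functions cardinality.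
From mathcomp Require Import reals.
From Stdlib Require Import Relation_Operators.

Set Implicit Arguments.
Unset Strict Implicit.
Unset Printing Implicit Defensive.

Import Order.TTheory GRing.Theory Num.Theory.

Local Open Scope classical_set_scope.
Local Open Scope quotient_scope.
Local Open Scope group_scope.

(** * Commuting products and cosets of finite index subgroups *)

Lemma perm_prodg_commute (G : groupType) (I : eqType) (F : I -> G)
    (s1 s2 : seq I) : (forall i j, commute (F i) (F j)) -> perm_eq s1 s2 ->
  \prod_(i <- s1) F i = \prod_(i <- s2) F i.
Proof.
move=> Fcomm; elim: s1 s2 => [|x s1 IHs] s2.
  by move/perm_size/esym/size0nil => ->.
move=> perm12; have xs2 : x \in s2 by rewrite -(perm_mem perm12) mem_head.
case/splitPr: xs2 perm12 => p1 p2.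
rewrite perm_sym -(cat1s x p2) perm_catCA /= perm_cons perm_sym.
move=> /IHs perm12.
rewrite big_cons perm12 !big_cat big_cons /= !mulgA; congr (_ * _).
exact: commute_prod.
Qed.

(** Turns $G/H$ into a finite type [T], so that permutations, products and maxima over cosets become
    available. *)
Lemma finite_index_cosets (G : groupType) (H : set G) :
  is_subgroup H -> finite_index H ->
  exists (T : finType) (idx : G -> T) (rep : T -> G),
    (forall x y, idx x = idx y <-> H (x^-1 * y)) /\ cancel rep idx.
Proof.
move=> [H1 HM HV] /finite_fsetP[X eqX].
have inX g : [set g * h | h in H] \in X.
  have : range (fun g : G => [set g * h | h in H]) [set g * h | h in H].
    by exists g.
  by rewrite eqX.
pose idx g : X := [` inX g]%fset.
have idxP x y : idx x = idx y <-> H (x^-1 * y).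
  split=> [/(congr1 val) /= eqxy|Hxy].
    have : [set y * h | h in H] y by exists 1; rewrite ?mulg1.
    by rewrite -eqxy => -[h Hh <-]; rewrite mulKg.
  apply/val_inj/seteqP; split=> _ [h Hh <-] /=.
    exists ((x^-1 * y)^-1 * h); first by apply: HM => //; apply: HV.
    by rewrite invgM invgK !mulgA mulgV mul1g.
  by exists (x^-1 * y * h); [apply: HM|rewrite !mulgA mulgV mul1g].
have repP (i : X) : exists g, idx g = i.
  have : range (fun g : G => [set g * h | h in H]) (val i).
    by rewrite eqX /=; exact: valP.
  by case=> g _ eqg; exists g; exact: val_inj.
have [rep repK] := choice repP.
by exists X, idx, rep.
Qed.

(** Left multiplication by [z] permutes the cosets of [H]; if [m] is the order of this permutation,
    [z ^+ m] fixes every coset $gH$. *)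
Lemma finite_index_core_exponent (G : groupType) (H : set G) (z : G) :
  is_subgroup H -> finite_index H ->
  exists2 m, (0 < m)%N & forall g, H (g^-1 * z ^+ m * g).
Proof.
move=> sgH fiH; have [H1 HM HV] := sgH.
have [T [idx [rep [idxP repK]]]] := finite_index_cosets sgH fiH.
have repidx g : H ((rep (idx g))^-1 * g) by apply/idxP; rewrite repK.
have act_inj : injective (fun i => idx (z * rep i)).
  move=> i j /idxP; rewrite invgM -mulgA mulKg => /idxP.
  by rewrite !repK.
pose p := perm act_inj.
have pX n i : (p ^+ n)%g i = idx (z ^+ n * rep i).
  elim: n => [|n IHn]; first by rewrite expg0 expg0 perm1 mul1g repK.
  rewrite expgSr permM IHn permE; apply/idxP.
  by rewrite invgM expgS -!mulgA mulKg; apply/idxP; rewrite repK.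
exists #[p]%g => [|g]; first exact: fingroup.order_gt0.
have /idxP : idx (rep (idx g)) = idx (z ^+ #[p]%g * rep (idx g)).
  by rewrite -pX expg_order perm1 repK.
move=> Hz; have := HM _ _ (HM _ _ (HV _ (repidx g)) Hz) (repidx g).
by rewrite invgM invgK !mulgA !mulgK.
Qed.

(** * Characters and central elements *)

Section Characters.
Variables (R : realType) (G : groupType) (phi : G -> R).
Hypothesis chi : is_character phi.

Lemma character1 : phi 1 = 0%R.
Proof. by apply: (@addrI R (phi 1)); rewrite -chi mulg1 addr0. Qed.

Lemma characterV g : phi g^-1 = (- phi g)%R.
Proof. by apply: (@addrI R (phi g)); rewrite -chi mulgV character1 subrr. Qed.

Lemma characterX g m : phi (g ^+ m) = (phi g *+ m)%R.
Proof.
elim: m => [|m IHm]; first by rewrite expg0 mulr0n character1.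
by rewrite expgS chi IHm mulrS.
Qed.

Lemma character_prod (I : Type) (r : seq I) (F : I -> G) :
  phi (\prod_(i <- r) F i) = (\sum_(i <- r) phi (F i))%R.
Proof.
by elim: r => [|i r IHr]; rewrite ?big_nil ?big_cons ?character1 // chi IHr.
Qed.

(* Some power of [z] lies in the normal core of [H], so the conjugates of that
   power commute, and their product over [G / H] is central. *)
Lemma character_eq0_centraliser (H : set G) (z : G) :
  is_subgroup H -> finite_index H ->
  (forall h, H h -> commute z h) ->
  (forall c, group_center G c -> phi c = 0%R) -> phi z = 0%R.
Proof.
move=> sgH fiH zH phiZ.
have [m m_gt0 zmH] := finite_index_core_exponent z sgH fiH.
have [T [idx [rep [idxP repK]]]] := finite_index_cosets sgH fiH.
pose F i := rep i * z ^+ m / rep i.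
(* Since [z ^+ m] commutes with [H], its conjugate by [g] depends only on the coset of [g]. *)
have conjE g : g * z ^+ m / g = F (idx g).
  pose h := (rep (idx g))^-1 * g.
  have Hh : H h by apply/idxP; rewrite repK.
  have zmh : z ^+ m * h = h * z ^+ m by apply/esym/commuteX/commute_sym/zH.
  have gE : g = rep (idx g) * h by rewrite mulVKg.
  rewrite [in LHS]gE /F invgM -(mulgA (rep _) h) -zmh.
  by clearbody h; rewrite !mulgA mulgK.
have Fcomm i j : commute (F i) (F j).
  (* Relative to [rep i], the factor [F j] is a conjugate [y] of [z ^+ m]. By the choice of [m], [y]
     lies in [H], so it commutes with [z ^+ m]. *)
  have [y zy Fj] : exists2 y, commute (z ^+ m) y & F j = rep i * y / rep i.
    exists ((rep i)^-1 * rep j * z ^+ m / ((rep i)^-1 * rep j)).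
      apply/commute_sym/commuteX/commute_sym/zH.
      by have := zmH ((rep j)^-1 * rep i); rewrite !invgM !invgK !mulgA.
    by rewrite /F !invgM !invgK !mulgA mulgV mul1g mulgK.
  rewrite /commute Fj /F !mulgA !mulgVK; congr (_ / _).
  by rewrite -!mulgA zy.
pose P := \prod_(i : T) F i.
have Pcentral : group_center G P.
  move=> x /=; apply/esym.
  (* Conjugation by [x] only permutes the factors of [P], by the action of [x] on the cosets. *)
  have s_inj : injective (fun i => idx (x * rep i)).
    move=> i j /idxP; rewrite invgM -mulgA mulKg => /idxP.
    by rewrite !repK.
  have FE i : F (idx (x * rep i)) = x * F i / x.
    by rewrite -conjE /F invgM !mulgA.
  apply/eqP; rewrite -divg_eq; apply/eqP.
  transitivity (\prod_(i : T) F (idx (x * rep i))).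
    rewrite /P; elim/big_rec2: _ => [|i y1 y2 _ IH].
      by rewrite mulg1 mulgV.
    by rewrite FE -IH !mulgA mulgVK.
  rewrite -(big_map _ xpredT F) ; apply: perm_prodg_commute => //.
  apply: uniq_perm; rewrite ?map_inj_uniq ?index_enum_uniq // => i.
  rewrite mem_index_enum; apply/mapP; exists (invF s_inj i).
    by rewrite mem_index_enum.
  by rewrite (f_invF s_inj).
have := phiZ _ Pcentral.
have -> : phi P = (phi z *+ m *+ #|T|)%R.
  rewrite character_prod (eq_bigr (fun=> phi z *+ m)%R) ?sumr_const // => i _.
  by rewrite /F !chi characterV characterX addrC addrA addNr add0r.
have T_gt0 : (0 < #|T|)%N by apply/card_gt0P; exists (idx 1).
move/eqP; rewrite -mulrnA mulrn_eq0 muln_eq0 !eqn0Ngt m_gt0 T_gt0 /=.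
by move/eqP.
Qed.

End Characters.

(** * Signed edge crossings in the Cayley tree of a free group *)

Section PresentedGroup.
Variables (X : choiceType) (rels : set (seq (X * bool))).
Local Notation G := (presented_group rels).
Local Notation "\[ w ]" := (\pi_(presented_group rels) w).

Lemma pres_genV (x : X) : \[[:: (x, false)]] = (pres_gen rels x)^-1.
Proof.
apply/esym/mulg1_eq; rewrite -[_ * _]/(pres_mul _ _) pres_pi_cat.
exact/pres_piP/pres_eq_cancel.
Qed.

Lemma presented_group_ind (P : G -> Prop) :
  P 1 ->
  (forall g x, P g -> P (g * pres_gen rels x)) ->
  (forall g x, P g -> P (g / pres_gen rels x)) ->
  forall g, P g.
Proof.
move=> P1 PM PV; elim/quotW; elim/last_ind => [|w [x b] Pw]; first exact: P1.
rewrite -cats1 -pres_pi_cat; case: b; first exact: PM.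
by rewrite pres_genV; exact: PV.
Qed.

End PresentedGroup.

Section EdgeCrossing.
Variable X : choiceType.
Local Notation F := (@presented_group X set0).
Local Notation gen := (@pres_gen X set0).
Local Notation "\[ w ]" := (\pi_(@presented_group X set0) w).
Variables (v : F) (u : X).

(* Signed number of times the edge path that starts at [g] and reads the word
   [w] in the Cayley tree runs through the edge from [v] to [v * gen u]. *)
Fixpoint crossing (g : F) (w : seq (X * bool)) : int :=
  if w is l :: w' then
    let g' := g * \[[:: l]] in
    ((if l.2 then ((l.1 == u) && (g == v))%:Z
      else - ((l.1 == u) && (g' == v))%:Z) + crossing g' w')%R
  else 0%R.

Lemma crossing_cat g w1 w2 :
  crossing g (w1 ++ w2) = (crossing g w1 + crossing (g * \[w1])%g w2)%R.
Proof.
elim: w1 g => [|l w1 IHw1] g /=; first by rewrite (mulg1 g) add0r.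
by rewrite IHw1 addrA -(mulgA g) -[_ * \[w1]]/(pres_mul _ _) pres_pi_cat.
Qed.

(** With no relators, only cancellations matter, and a letter followed by its inverse crosses the
    edge with opposite signs. *)
Lemma crossing_pres_eq w1 w2 : pres_eq set0 w1 w2 ->
  forall g, crossing g w1 = crossing g w2.
Proof.
elim=> {w1 w2} [//|w1 w2 _ IH g|w1 w2 w3 _ IH1 _ IH2 g
  |w1 w1' w2 w2' eqw1 IH1 _ IH2 g|x b g|//].
- by rewrite IH.
- by rewrite IH1.
- rewrite !crossing_cat IH1 IH2; congr (_ + crossing (g * _)%g _)%R.
  exact/pres_piP.
- rewrite /= addr0.
  have -> : g * \[[:: (x, b)]] * \[[:: (x, ~~ b)]] = g.
    rewrite -mulgA -[X in g * X]/(pres_mul _ _) pres_pi_cat.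
    have /pres_piP-> := pres_eq_cancel set0 x b.
    exact: mulg1.
  by case: b => /=; rewrite ?subrr ?addNr.
Qed.

(** Removing the edge cuts the tree in two; this is zero exactly when [w] lies on the same side as
    [1]. *)
Definition tree_side (w : F) : int := crossing 1 (repr w).

Lemma tree_side1 : tree_side 1 = 0%R.
Proof.
rewrite /tree_side (crossing_pres_eq (w2 := [::])) //.
exact/pres_piP/reprK.
Qed.

Lemma tree_sideM w x :
  tree_side (w * gen x) = (tree_side w + ((x == u) && (w == v))%:Z)%R.
Proof.
rewrite /tree_side (crossing_pres_eq (w2 := repr w ++ [:: (x, true)])).
  by rewrite crossing_cat reprK /= addr0 mul1g.
apply/pres_piP; rewrite reprK -pres_pi_cat reprK.
exact: erefl.
Qed.

End EdgeCrossing.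

(** * Characters of free groups and disconnected half spaces *)

Lemma finite_set_bounded (R : realType) (T : eqType) (A : set T) (b : T -> R) :
  finite_set A -> exists M : R, forall x, A x -> (b x <= M)%R.
Proof.
move=> /finite_seqP[s ->] /=; elim: s => [|y s [M bM]]; first by exists 0%R.
exists (Num.max (b y) M) => x /=; rewrite inE le_max.
by case/orP=> [/eqP->|/bM->]; rewrite ?lexx ?orbT.
Qed.

Lemma archimedean_mulrn (R : realType) (a b : R) : (0 < a)%R ->
  exists N, (b < a *+ N)%R.
Proof.
move=> a_gt0; exists (Num.bound (`|b| / a))%R.
rewrite -mulr_natr -ltr_pdivrMl // mulrC.
apply: le_lt_trans (archi_boundP _); last by rewrite divr_ge0 // ltW.
by rewrite ler_pM2r ?invr_gt0 // ler_norm.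
Qed.

Section FreeCharacter.
Variables (R : realType) (X : choiceType).
Local Notation F := (@presented_group X set0).
Local Notation gen := (@pres_gen X set0).
Variable psi : F -> R.
Hypothesis chpsi : is_character psi.

(** [M] controls how far [psi] can drop along the path spelled by [e]; a path starting that far
    above [v] never meets [v]. The bound depends on [e] alone. *)
Lemma tree_side_constant (e : F) : exists M : R, forall v u a,
  (psi v + M < psi a)%R -> tree_side v u (a * e) = tree_side v u a.
Proof.
elim/presented_group_ind: e => [|e x [M IH]|e x [M IH]].
- by exists 0%R => v u a _; congr (tree_side v u _); exact: mulg1.
(* [M + |M|] is nonnegative, so the bound both feeds the induction hypothesis and keeps [a * e] away
   from [v]. *)
- exists (M + `|M| + `|psi e|)%R => v u a av.
  rewrite mulgA tree_sideM IH.
    have -> : a * e == v = false.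
      apply/eqP => /(congr1 psi); rewrite chpsi => aev.
      have := ler_norm M; have := ler_norm (- M)%R.
      have := ler_norm (psi e); have := ler_norm (- psi e)%R.
      by rewrite !normrN; lra.
    by rewrite andbF addr0.
  by have := normr_ge0 M; have := normr_ge0 (psi e); lra.
- exists (M + `|M| + `|psi e| + `|psi (gen x)|)%R => v u a av.
  (* An inverse letter is handled by reading its edge backwards from its far end. *)
  have := tree_sideM v u (a * (e / gen x)) x.
  have -> : a * (e / gen x) == v = false.
    apply/eqP => /(congr1 psi); rewrite !chpsi (characterV chpsi) => aev.
    have := ler_norm M; have := ler_norm (- M)%R.
    have := ler_norm (psi e); have := ler_norm (- psi e)%R.
    have := ler_norm (psi (gen x)); have := ler_norm (- psi (gen x))%R.
    by rewrite !normrN; lra.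
  rewrite andbF addr0 => <-.
  rewrite -mulgA mulgVK IH //.
  have := normr_ge0 M; have := normr_ge0 (psi e).
  by have := normr_ge0 (psi (gen x)); lra.
Qed.

(** Steps labelled [t] never cross an edge labelled [u]; [l] is whichever of [gen t] and its inverse
    lowers [psi]. *)
Lemma tree_side_invariant (t u : X) : t != u -> psi (gen t) <> 0%R ->
  exists2 l : F, (psi l < 0)%R &
    forall v w m, tree_side v u (w * l ^+ m) = tree_side v u w.
Proof.
move=> tu /eqP psit.
have invt v w : tree_side v u (w * gen t) = tree_side v u w.
  by rewrite tree_sideM (negPf tu) addr0.
have invtV v w : tree_side v u (w / gen t) = tree_side v u w.
  by rewrite -(invt v (w / gen t)) mulgVK.
have invX l : (forall v w, tree_side v u (w * l) = tree_side v u w) ->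
    forall v w m, tree_side v u (w * l ^+ m) = tree_side v u w.
  move=> invl v w; elim=> [|m IHm]; first by rewrite expg0 mulg1.
  by rewrite expgSr mulgA invl.
move: psit; rewrite neq_lt => /orP[psit|psit].
  by exists (gen t) => //; exact: invX.
exists (gen t)^-1; last exact: invX.
by rewrite (characterV chpsi) oppr_lt0.
Qed.

Lemma tree_side_separates (t u : X) (K : R) : t != u -> psi (gen t) <> 0%R ->
  exists v w, [/\ (psi v < K)%R, (0 <= psi w)%R & tree_side v u w <> 0%R].
Proof.
move=> tu psit.
have [l l_lt0 linv] := tree_side_invariant tu psit.
(* [N] puts [l ^+ N] below [K] and makes the final climb by $l^{-2N}$ outweigh both the descent and
   the letter [u]. *)
have [N KN] := @archimedean_mulrn R (- psi l) (`|K| + `|psi (gen u)|)%R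
  (etrans (oppr_gt0 _) l_lt0).
rewrite mulNrn in KN.
have lVinv v w m : tree_side v u (w / l ^+ m) = tree_side v u w.
  by rewrite -(linv v _ m) mulgVK.
have := ler_norm (- K)%R; have := ler_norm (- psi (gen u))%R.
have := normr_ge0 K; have := normr_ge0 (psi (gen u)); rewrite !normrN => *.
exists (l ^+ N), (l ^+ N * gen u / l ^+ N / l ^+ N); split.
- by rewrite (characterX chpsi); lra.
- by rewrite !chpsi !(characterV chpsi) !(characterX chpsi); lra.
- rewrite !lVinv tree_sideM -[X in tree_side _ _ X]mul1g linv tree_side1.
  by rewrite !eqxx.
Qed.

End FreeCharacter.

(* Coarse projection: after multiplying [g] on the right by a representative of
   its coset, [p] gives a map from [G] to the tree of the free group that moves
   Cayley-adjacent vertices a bounded distance, so a connected half space of [G]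
   would let one go around the vertex [v]. *)
Lemma half_cayley_disconnected (R : realType) (G : groupType) (phi : G -> R)
    (H : set G) (X : choiceType) (p : G -> @presented_group X set0)
    (psi : @presented_group X set0 -> R) (S : set G) (t u : X) :
  is_character phi -> is_character psi ->
  is_subgroup H -> finite_index H ->
  (forall x y, H x -> H y -> p (x * y) = p x * p y) ->
  (forall w, exists2 h, H h & p h = w) ->
  (forall h, H h -> phi h = psi (p h)) ->
  t != u -> psi (pres_gen set0 t) <> 0%R ->
  finite_set S -> ~ half_cayley_connected S phi.
Proof.
move=> chphi chpsi sgH fiH pM p_onto phipsi tu psit finS conn.
have [H1 HM HV] := sgH.
have [T [idx [rep [idxP repK]]]] := finite_index_cosets sgH fiH.
(* [idx] classifies left cosets, so the inverse is what makes right multiplication by [r g] land in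
   [H]. *)
pose r g := rep (idx g^-1).
have Hr g : H (g * r g) by rewrite -{1}[g]invgK; apply/idxP; rewrite repK.
pose tau g := p (g * r g).
have [M MP] := choice (tree_side_constant chpsi).
have [C phir] : exists C : R, forall g, (- phi (r g) <= C)%R.
  have [C rC] := finite_set_bounded (fun i => - phi (rep i))%R
    (@finite_finset T setT).
  by exists C => g; exact: rC.
(* A Cayley step moves [tau] by one of finitely many elements, indexed by two cosets and a
   generator; [K] bounds their constants. *)
have [K MK] := finite_set_bounded
  (fun x : T * T * G => M (p ((rep x.1.1)^-1 * x.2 * rep x.1.2)))
  (finite_setX (@finite_finset _ (@setT (T * T))) finS).
have psitau g : (phi g - C <= psi (tau g))%R.
  by rewrite -phipsi // chphi; have := phir g; lra.
(* On the half space [psi] of [tau] is at least [- C], so a step cannot cross an edge at a vertex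
   [v] below [- C - K]. *)
have step v : (psi v < - C - K)%R ->
    forall x y, half_cayley_edge S phi x y ->
    tree_side v u (tau x) = tree_side v u (tau y).
  move=> vC x y [x_ge0 _ [s Ss ->{y}]].
  have Hs : H ((r x)^-1 * s * r (x * s)).
    have := HM _ _ (HV _ (Hr x)) (Hr (x * s)).
    by rewrite invgM !mulgA mulgVK.
  have -> : tau (x * s) = tau x * p ((r x)^-1 * s * r (x * s)).
    by rewrite -pM // /tau !mulgA mulgK.
  apply/esym/MP; have := psitau x.
  have := MK (idx x^-1, idx (x * s)^-1, s) (conj I Ss).
  by rewrite /= -!/(r _); lra.
(* The projection starts at [tau 1] instead of [1]; the second bound on [v] removes this offset at
   both ends of the path. *)
have tau_const v w : (psi v < - C - K)%R -> (psi v < - M (tau 1%g))%R ->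
    (0 <= psi w)%R -> tree_side v u w = 0%R.
  move=> v1 v2 w_ge0.
  have [h Hh ph] := p_onto w.
  have r1 : H (r 1) by have := Hr 1; rewrite mul1g.
  have tauh : tau h = w * tau 1.
    rewrite /tau mul1g -ph -pM //; congr (p (h * rep _)).
    by apply/idxP; rewrite invgK invg1 mulg1.
  have psi1 := character1 chpsi.
  rewrite -(@MP (tau 1%g) v u w); last by lra.
  rewrite -tauh -[RHS](tree_side1 v u).
  rewrite -[in RHS](@MP (tau 1) v u 1); last by lra.
  rewrite mul1g; apply/esym.
  have phih : (0 <= phi h)%R by rewrite phipsi // ph.
  have phi1 : (0 <= phi 1%g)%R by rewrite (character1 chphi).
  elim: (conn _ _ phi1 phih) => {h Hh ph tauh phih}
    [x y|//|x y _ ->//|x y z _ -> _ ->//].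
  exact: step.
have [v [w [v_lt w_ge0]]] := tree_side_separates chpsi
  (- (`|C + K| + `|M (tau 1%g)|))%R tu psit.
apply; apply: tau_const => //.
  by have := ler_norm (C + K)%R; have := normr_ge0 (M (tau 1%g)); lra.
by have := ler_norm (M (tau 1%g)); have := normr_ge0 (C + K)%R; lra.
Qed.

(** * Connectedness from a central element *)

Lemma half_cayley_connected_central (R : realType) (G : groupType)
    (phi : G -> R) (S : set G) (z : G) :
  is_character phi -> generates S -> group_center G z -> (0 < phi z)%R ->
  half_cayley_connected (S `|` [set z]) phi.
Proof.
move=> chphi genS zC z_gt0.
pose conn := clos_refl_sym_trans G (half_cayley_edge (S `|` [set z]) phi).
have zcomm g n : commute g (z ^+ n) by apply: commuteX; apply/esym/zC.
have connz x n : (0 <= phi x)%R -> conn x (x * z ^+ n).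
  move=> x_ge0; elim: n => [|n IHn].
    by rewrite expg0 mulg1; exact: rst_refl.
  apply: rst_trans IHn _; apply: rst_step; rewrite expgSr mulgA.
  have xn_ge0 : (0 <= phi (x * z ^+ n)%g)%R.
    by rewrite chphi (characterX chphi) addr_ge0 // mulrn_wge0 // ltW.
  by split=> //; [rewrite chphi addr_ge0 // ltW|exists z => //; right].
(* Allowing every base point [x] is what makes [K] closed under products. *)
pose K : set G := [set g | forall x, (0 <= phi x)%R -> (0 <= phi (x * g)%g)%R ->
  conn x (x * g)].
have sgK : is_subgroup K.
  split=> [x _ _|g h Kg Kh x x_ge0 xgh_ge0|g Kg x x_ge0 xg_ge0].
  - by rewrite mulg1; exact: rst_refl.
  (* The midpoint [x * g] may leave the half space; the path is lifted by [z ^+ N], which centrality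
     moves to the end, where it is undone. *)
  - have [N gN] := archimedean_mulrn (- phi (x * g)%g)%R z_gt0.
    have xz_ge0 : (0 <= phi (x * z ^+ N)%g)%R.
      by rewrite chphi (characterX chphi) addr_ge0 // mulrn_wge0 // ltW.
    have xzg_ge0 : (0 <= phi (x * z ^+ N * g)%g)%R.
      by rewrite -mulgA -zcomm mulgA chphi (characterX chphi); lra.
    have xzghE : x * z ^+ N * g * h = x * (g * h) * z ^+ N.
      by rewrite -!mulgA; congr (_ * _); rewrite -zcomm -mulgA.
    apply: rst_trans (connz x N x_ge0) _.
    apply: rst_trans (Kg _ xz_ge0 xzg_ge0) _.
    apply: rst_trans (Kh _ xzg_ge0 _) _.
      by rewrite xzghE chphi (characterX chphi) addr_ge0 // mulrn_wge0 // ltW.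
    by rewrite xzghE; apply/rst_sym/connz.
  - apply: rst_sym; rewrite -{2}(mulgVK g x); apply: Kg => //.
    by rewrite mulgVK.
have KT : K = setT.
  apply: genS => // s Ss x x_ge0 xs_ge0; apply: rst_step.
  by split=> //; exists s => //; left.
move=> x y x_ge0 y_ge0; have := mulVKg x y; set g := x^-1 * y => yE.
have Kg : K g by rewrite KT.
by rewrite -yE; apply: Kg; rewrite ?yE.
Qed.

(** * Finite generation, inherited from a finite index subgroup *)

Definition finitely_generated (G : groupType) : Prop :=
  exists2 S : set G, finite_set S & generates S.

Lemma finitely_generated_free_abelian (n : nat) :
  finitely_generated (free_abelian_group n).
Proof.
exists (range (fun i : 'I_n => delta_mx 0%R i : 'rV[int]_n)).
  exact/finite_image/finite_finset.
move=> K [K1 KM KV] SK; apply/seteqP; split=> // a _.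
have KD (b c : 'rV[int]_n) : K b -> K c -> K (b + c)%R by exact: KM.
have KN (b : 'rV[int]_n) : K b -> K (- b)%R by exact: KV.
have K0 : K (0%R : 'rV[int]_n) by [].
have Kn (b : 'rV[int]_n) m : K b -> K (b *+ m)%R.
  by move=> Kb; elim: m => [|m IHm]; rewrite ?mulr0n ?mulrS //; exact: KD.
suff KT (b : 'rV[int]_n) : K b by exact: KT.
rewrite [b]row_sum_delta; apply: (big_ind K K0 KD) => i _.
have Ki : K (delta_mx 0%R i : 'rV[int]_n) by apply: SK; exists i.
rewrite -[b _ _]intz scaler_int.
by case: (b _ _) => m; rewrite ?NegzE ?mulrNz; [|apply: KN]; exact: Kn.
Qed.

Lemma finitely_generated_free_group (k : nat) :
  finitely_generated (free_group k).
Proof.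
exists (range (fun i : 'I_k => pres_gen set0 i)).
  exact/finite_image/finite_finset.
move=> K [K1 KM KV] SK; apply/seteqP; split=> // w _.
have Kgen i : K (pres_gen set0 i) by apply: SK; exists i.
elim/presented_group_ind: w => // w i Kw; apply: KM => //; exact: KV.
Qed.

Lemma finitely_generated_prod (A B : groupType) :
  finitely_generated A -> finitely_generated B ->
  finitely_generated (A * B)%type.
Proof.
move=> [SA finA genA] [SB finB genB].
exists ([set (a, 1) | a in SA] `|` [set (1, b) | b in SB]).
  by rewrite finite_setU; split; exact: finite_image.
move=> K [K1 KM KV] SK.
have KA : [set a | K (a, 1)] = setT.
  apply: genA => [|a SAa]; last by apply: SK; left; exists a.
  split=> [//|a a' /= Ka Ka'|a /= /KV].
    by have := KM _ _ Ka Ka'; rewrite -[_ * _]/(a * a', 1 * 1) mulg1.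
  by rewrite -[_^-1]/(a^-1, 1^-1) invg1.
have KB : [set b | K (1, b)] = setT.
  apply: genB => [|b SBb]; last by apply: SK; right; exists b.
  split=> [//|b b' /= Kb Kb'|b /= /KV].
    by have := KM _ _ Kb Kb'; rewrite -[_ * _]/(1 * 1, b * b') mulg1.
  by rewrite -[_^-1]/(1^-1, b^-1) invg1.
apply/seteqP; split=> // -[a b] _.
have -> : (a, b) = (a, 1) * (1, b) :> (A * B)%type.
  by rewrite -[RHS]/(a * 1, 1 * b) mulg1 mul1g.
apply: KM; first by rewrite -[K _]/([set a | K (a, 1)] a) KA.
by rewrite -[K _]/([set b | K (1, b)] b) KB.
Qed.

Lemma multiplicative1 (B G : groupType) (f : {multiplicative B -> G}) : f 1 = 1.
Proof. by apply: (@mulgI G (f 1)); rewrite -gmulfM !mulg1. Qed.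

Lemma multiplicativeV (B G : groupType) (f : {multiplicative B -> G}) x :
  f x^-1 = (f x)^-1.
Proof. by apply/esym/mulg1_eq; rewrite -gmulfM mulgV multiplicative1. Qed.

Lemma range_is_subgroup (B G : groupType) (f : {multiplicative B -> G}) :
  is_subgroup (range f).
Proof.
split=> [|_ _ [x _ <-] [y _ <-]|_ [x _ <-]].
- by exists 1; rewrite // multiplicative1.
- by exists (x * y); rewrite // gmulfM.
- by exists x^-1; rewrite // multiplicativeV.
Qed.

Lemma finitely_generated_finite_index (B G : groupType)
    (f : {multiplicative B -> G}) :
  finite_index (range f) -> finitely_generated B -> finitely_generated G.
Proof.
move=> fiH [SB finS genS].
have [T [idx [rep [idxP repK]]]] :=
  finite_index_cosets (range_is_subgroup f) fiH.
exists (f @` SB `|` range rep).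
  by rewrite finite_setU; split; exact: finite_image.
move=> K [K1 KM KV] SK; apply/seteqP; split=> // g _.
have Kf : f @^-1` K = setT.
  apply: genS => [|b SBb]; last by apply: SK; left; exists b.
  split=> [|x y /= Kx Ky|x /= Kx]; first by rewrite /= multiplicative1.
    by rewrite gmulfM; exact: KM.
  by rewrite multiplicativeV; exact: KV.
have /idxP[b _ fb] : idx (rep (idx g)) = idx g by rewrite repK.
rewrite -(mulVKg (rep (idx g)) g) -fb; apply: KM.
  by apply: SK; right; exists (idx g).
by rewrite -[K _]/((f @^-1` K) b) Kf.
Qed.

(** * The two inclusions *)

Lemma half_cayley_disconnected_center (R : realType) (G : groupType) (n k : nat)
    (f : {multiplicative (free_abelian_group n * free_group k)%type -> G})
    (phi : G -> R) (S : set G) :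
  (2 <= k)%N -> injective f -> finite_index (range f) ->
  nonzero_char phi -> (forall c, group_center G c -> phi c = 0%R) ->
  finite_set S -> ~ half_cayley_connected S phi.
Proof.
move=> k_ge2 f_inj fiH [chphi [g phig]] phiZ finS.
have sgH := range_is_subgroup f.
have phiA a : phi (f (a, 1)) = 0%R.
  apply: (character_eq0_centraliser chphi sgH fiH) => // _ [[b w] _ <-].
  rewrite /commute -!gmulfM; congr (f _).
  rewrite -[LHS]/(a * b, 1 * w) -[RHS]/(b * a, w * 1) mul1g mulg1.
  by congr (_, _); exact: addrC.
pose psi (w : free_group k) := phi (f (1, w)).
have chpsi : is_character psi.
  move=> x y; rewrite /psi -chphi -gmulfM.
  by rewrite -[(1, x) * (1, y)]/(1 * 1, x * y) mulg1.
(* Left inverse of [f], with arbitrary values outside [range f]; its second component is the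
   projection onto $F_k$. *)
have [q qf] : exists q : G -> free_abelian_group n * free_group k, cancel f q.
  have qP y : exists x, range f y -> f x = y.
    by have [[x _ <-]|ny] := pselect (range f y); [exists x|exists 1].
  have [q qP'] := choice qP; exists q => x; apply: f_inj.
  by apply: qP'; exists x.
have phipsi h : range f h -> phi h = psi (q h).2.
  move=> [[a w] _ <-]; rewrite qf /psi /=.
  rewrite -[RHS]add0r -(phiA a) -chphi -gmulfM.
  by rewrite -[(a, 1) * (1, w)]/(a * 1, 1 * w) mulg1 mul1g.
have [t psit] : exists t, psi (pres_gen set0 t) <> 0%R.
  apply: contrapT => psi0.
  have {}psi0 t : psi (pres_gen set0 t) = 0%R.
    by apply: contrapT => psit; apply: psi0; exists t.
  have {}psi0 w : psi w = 0%R.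
    elim/presented_group_ind: w => [|w t IHw|w t IHw].
    - exact: character1 chpsi.
    - by rewrite chpsi IHw psi0 addr0.
    - by rewrite chpsi (characterV chpsi) IHw psi0 subr0.
  (* If [psi] vanished, so would [phi] on [range f], which contains a positive power of [g]; this
     contradicts [phig]. *)
  have [m m_gt0 gmH] := finite_index_core_exponent g sgH fiH.
  have := gmH 1; rewrite invg1 mul1g mulg1 => /phipsi.
  rewrite psi0 (characterX chphi) => /eqP.
  by rewrite mulrn_eq0 eqn0Ngt m_gt0 => /eqP.
have [u tu] : exists u, t != u.
  have k_gt0 : (0 < k)%N by exact: ltnW.
  have [t0|] := eqVneq t (Ordinal k_gt0); last by exists (Ordinal k_gt0).
  by exists (Ordinal k_ge2); rewrite t0.
apply: (@half_cayley_disconnected _ _ _ (range f) _ (fun x => (q x).2)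
  psi S t u) => //.
- by move=> _ _ [x _ <-] [y _ <-]; rewrite -gmulfM !qf.
- by move=> w; exists (f (1, w)); [exists (1, w)|rewrite qf].
Qed.

Lemma char_class_refl (R : realType) (G : groupType) (phi : G -> R) :
  nonzero_char phi -> char_class phi phi.
Proof. by move=> nz; split=> //; exists 1%R => // g; rewrite mul1r. Qed.

Theorem proposition3p4 (R : realType) (n : nat) (hn : (1 <= n)%N)
    (G : groupType) (hGBS : is_GBS n G)
    (hunimod : exists2 k : nat, (2 <= k)%N & virtually_Zn_x_Fk n k G) :
  BNS_invariant R G = char_sphere R G `\` char_sphere_rel R (group_center G).
Proof.
have [k k_ge2 [f [f_inj fiH]]] := hunimod.
apply/seteqP; split=> [_ [phi [nzphi [S [finS _ conn]]] <-]|].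
  split; first by exists phi.
  move=> [psi [nzpsi psiZ] eqc].
  (* Equal classes make [psi] a positive multiple of [phi], so [phi] vanishes on the center too. *)
  have := char_class_refl nzphi; rewrite -eqc => -[_ [c c_gt0 psiE]].
  apply: (half_cayley_disconnected_center k_ge2 f_inj fiH nzphi _ finS conn).
  move=> z /psiZ; rewrite psiE => /eqP.
  by rewrite mulf_eq0 gt_eqF //= => /eqP.
move=> _ [[phi nzphi <-] notrel]; have chphi := nzphi.1.
exists phi => //; split=> //.
have [z zC phiz] : exists2 z, group_center G z & phi z != 0%R.
  apply: contrapT => phiZ; apply: notrel; exists phi => //; split=> // z zC.
  by apply/eqP/negP => /negP phiz; apply: phiZ; exists z.
have [z' z'C z'_gt0] : exists2 z, group_center G z & (0 < phi z)%R.
  move: phiz; rewrite neq_lt => /orP[z_lt0|]; last by exists z.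
  exists z^-1; last by rewrite (characterV chphi) oppr_gt0.
  by move=> g /=; apply/commute_sym/commuteV/commute_sym/zC.
have [S finS genS] : finitely_generated G.
  apply: finitely_generated_finite_index fiH _.
  exact: finitely_generated_prod (finitely_generated_free_abelian n)
    (finitely_generated_free_group k).
exists (S `|` [set z']); split.
- by rewrite finite_setU; split=> //; exact: finite_set1.
- by move=> K sgK SK; apply: genS => // s Ss; apply: SK; left.
- exact: half_cayley_connected_central.
Qed.
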